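(* Assume that $0<\alpha\le1$ and $A(v)=(1-v)^{-p}$ with $0<p\le\alpha$, and that $v_R<1$ and $v_\delta<1$. Suppose that $y_R:=c-u_R>0$ and $$B_R:=\rho_R(c-u_R)^2-\frac{A(v_R)}{\rho_R^\alpha}>0.$$ Let $W_R=F(H_R)-cH_R$. Then the reduced system $$\frac{dH}{d\tau}=F(H)-cH-W_R$$ has a trajectory $H_R(\zeta)=(\rho_R(\zeta),u_R(\zeta),v_R(\zeta))$, $0<\zeta<+\infty$ (with $\zeta$ the reparametrized time $d\tau=\rho\,d\zeta$), such that $$H_R(\zeta)\to(\rho_R,u_R,v_R)\quad\text{as }\zeta\to+\infty.$$ Moreover $$\rho_R(\zeta)\to+\infty,\qquad u_R(\zeta)\to c,\qquad v_R(\zeta)\to v_\delta\qquad\text{as }\zeta\to0^+.$$ More precisely, $$c-u_R(\zeta)=B_R\zeta+o(\zeta),\qquad \frac1{\rho_R(\zeta)}=\frac{B_R}2\zeta^2+o(\zeta^2),\qquad v_R(\zeta)-v_\delta=\Gamma_R\zeta+o(\zeta)$$ as $\zeta\to0^+$, where, with $W_R=(w_{1,R},w_{2,R},w_{3,R})^T$, $$\Gamma_R=v_\delta w_{1,R}-w_{3,R}=\rho_R(u_R-c)(v_\delta-v_R).$$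
   Context: Here $H=(\rho,\rho u,\rho v)^T$ with $\rho>0$, $F(H)=(\rho u,\ \rho u^2-A(v)\rho^{-\alpha},\ \rho uv)^T$; trajectories are described in the primitive variables $(\rho,u,v)$. $(\rho_R,u_R,v_R)$, $\rho_R>0$, is the right Riemann state and $H_R=(\rho_R,\rho_Ru_R,\rho_Rv_R)^T$. $c$ is the singular-shock speed and $v_\delta$ the associated transported state: for a left state $(\rho_L,u_L,v_L)$ and $[\cdot]=\cdot_R-\cdot_L$, $c$ satisfies $k_1:=c[\rho]-[\rho u]>0$, $c[\rho u]-[\rho u^2-A(v)\rho^{-\alpha}]=ck_1$, and $v_\delta=k_3/k_1$ with $k_3=c[\rho v]-[\rho uv]$. *)

(* Defs.v *)
From Stdlib Require Import Reals.
From Coquelicot Require Import Coquelicot.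
Open Scope R_scope.

(* R^3 with Coquelicot's product normed-module structure.  It carries both the
   conserved variables H = (rho, rho u, rho v) and the primitive variables
   (rho, u, v). *)
Definition vec3 : Type := (R * R * R)%type.

(* Real powers are [Rpower], meaningful for a positive base only: hence the
   state space below. *)
Definition pressure (p v : R) : R := Rpower (1 - v) (- p).

Definition admissible (rho v : R) : Prop := 0 < rho /\ v < 1.

Definition conserved (rho u v : R) : vec3 := (rho, rho * u, rho * v).

(* The momentum flux rho u^2 - A(v) rho^(-alpha). *)
Definition momentum_flux (alpha p rho u v : R) : R :=
  rho * u ^ 2 - pressure p v * Rpower rho (- alpha).

(* F is a function of the conserved variables; u and v are recovered by
   division by rho, and states with rho <= 0 are excluded by [admissible]. *)
Definition flux (alpha p : R) (H : vec3) : vec3 :=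
  let '(rho, m, s) := H in
  let u := m / rho in
  let v := s / rho in
  (rho * u, momentum_flux alpha p rho u v, rho * u * v).

Definition moving_flux (alpha p c : R) (H : vec3) : vec3 :=
  minus (flux alpha p H) (scal c H : vec3).

(* c is the speed, and vd the transported value of v, of the singular shock
   joining (rhoL, uL, vL) to (rhoR, uR, vR). *)
Definition singular_shock
    (alpha p rhoL uL vL rhoR uR vR c vd : R) : Prop :=
  let k1 := c * (rhoR - rhoL) - (rhoR * uR - rhoL * uL) in
  let k2 := c * (rhoR * uR - rhoL * uL)
            - (momentum_flux alpha p rhoR uR vR
               - momentum_flux alpha p rhoL uL vL) in
  let k3 := c * (rhoR * vR - rhoL * vL) - (rhoR * uR * vR - rhoL * uL * vL) in
  0 < k1 /\ k2 = c * k1 /\ vd = k3 / k1.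

(* (rho, u, v), as functions of zeta in (0, +oo), is a trajectory of
   dH/dtau = F(H) - c H - W in the reparametrized time d tau = rho d zeta:
   [Hs] is the solution in the original time, defined on the open interval
   tau((0, +oo)).  Values at zeta <= 0 play no role. *)
Definition reparametrized_trajectory
    (alpha p c : R) (W : vec3) (rho u v : R -> R) : Prop :=
  exists (tau : R -> R) (Hs : R -> vec3),
    forall zeta : R, 0 < zeta ->
      admissible (rho zeta) (v zeta) /\
      is_derive tau zeta (rho zeta) /\
      Hs (tau zeta) = conserved (rho zeta) (u zeta) (v zeta) /\
      is_derive Hs (tau zeta) (minus (moving_flux alpha p c (Hs (tau zeta))) W).

(* f = g + o(h) as zeta -> 0+ ; [is_domin F h e] reads e = o(h) along F. *)
Definition expansion_at_0plus (f g h : R -> R) : Prop :=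
  is_domin (at_right 0) h (fun zeta => f zeta - g zeta).

(* Main.v *)
Require Import Defs.
From Stdlib Require Import Reals Ranalysis5 Lra ClassicalEpsilon.
From Coquelicot Require Import Coquelicot.
Open Scope R_scope.

(** In the time [zeta] and the variables [r = 1 / rho], [y = c - u], [v], and
    with [a = rhoR (c - uR)], the reduced system becomes
    [[
      r' = y - a r,   y' = B + A(v) r^alpha - a y,   v' = a (vR - v),
    ]]
    with [B] the constant called [BR] in the theorem.  The last equation is
    solved by [v = vR + (vdelta - vR) exp (- a zeta)], which stays between
    [vdelta] and [vR].  The singular shock is the point [r = y = 0], and the
    first two equations are the scalar equation
    [[
      (D + a)^2 r = f,   f = B + g r^alpha,   g(zeta) = A(v(zeta)),
    ]]
    with [r(0) = r'(0) = 0].  Here [D + a] is inverted by [relax a], so that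
    [r = relax a (relax a f)] and [f] is a fixed point.

    For [alpha < 1] the power [r^alpha] is not Lipschitz at the starting point,
    so the usual contraction in a sup norm is not available.  What helps is that [relax a]
    is linear and order-preserving and that [r^alpha] is concave: multiplying
    [r] by [lambda >= 1] multiplies [g r^alpha] by at most [lambda].  The
    constant [B > 0] is not multiplied at all, so that one step of the iteration
    strictly contracts the ratio of two bounded positive candidates
    ([force_step_ratio]); the iterates then converge geometrically
    ([force_iter_converges]).

    Boundedness and the limit at infinity both come from one comparison.  The
    rest point satisfies [a^2 rR = B + A(vR) rR^alpha], and
    [|r^alpha - rR^alpha| <= (rR^alpha / rR) |r - rR|]
    ([pw_close]), so that [|r - rR|] obeys a linear inequality whose limiting
    coefficient [A(vR) rR^alpha / rR = a^2 - B / rR] is below [a^2].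
    Hence it has an exponentially decaying supersolution
    ([decaying_supersolution]), below which all iterates stay.

    Near [zeta = 0], [f(0) = B] gives [y'(0) = B] and [r'(0) = 0], hence the
    expansions.  Finally [tau] is a primitive of [1 / r], and the solution
    in the original time is obtained by inverting it ([time_change]). *)

(** * Time changes *)

Lemma continuity_pt_of_is_derive (f : R -> R) (x l : R) :
  is_derive f x l -> continuity_pt f x.
Proof.
  intro H. apply continuity_pt_filterlim, (ex_derive_continuous f).
  now exists l.
Qed.

Lemma strictly_increasing_of_derive (f df : R -> R) (lo : R) :
  (forall x, lo < x -> is_derive f x (df x)) ->
  (forall x, lo < x -> 0 < df x) ->
  forall x y, lo < x -> x < y -> f x < f y.
Proof.
  intros Hd Hpos x y Hx Hxy.
  destruct (MVT_gen f x y df) as [z [Hz Hf]].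
  - rewrite Rmin_left, Rmax_right by lra. intros t Ht. apply Hd. lra.
  - rewrite Rmin_left, Rmax_right by lra. intros t Ht.
    apply (continuity_pt_of_is_derive f t (df t)), Hd. lra.
  - rewrite Rmin_left, Rmax_right in Hz by lra.
    assert (0 < df z) by (apply Hpos; lra). nra.
Qed.

(** The inverse is only known on the range of [f], which is a neighbourhood of
    each of its points by the intermediate value theorem. *)
Lemma is_derive_inverse (f g df : R -> R) :
  (forall x, 0 < x -> is_derive f x (df x)) ->
  (forall x, 0 < x -> 0 < df x) ->
  (forall x, 0 < x -> g (f x) = x) ->
  forall x, 0 < x -> is_derive g (f x) (/ df x).
Proof.
  intros Hd Hpos Hinv x Hx.
  assert (Hinc := strictly_increasing_of_derive f df 0 Hd Hpos).
  assert (Hcont : forall a, 0 < a -> continuity_pt f a).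
  { intros a Ha. now apply (continuity_pt_of_is_derive f a (df a)), Hd. }
  assert (Hlb : f (x / 2) < f x) by (apply Hinc; lra).
  assert (Hub : f x < f (2 * x)) by (apply Hinc; lra).
  assert (Hgc : continuity_pt g (f x)).
  { apply (continuity_pt_recip_prelim f g (x / 2) (2 * x)).
    - lra.
    - intros s t H1 H2 _. apply Hinc; lra.
    - intros s Hs. unfold comp, id. apply Hinv. lra.
    - intros s Hs. apply Hcont. lra.
    - lra. }
  assert (Hsurj : forall t, f (x / 2) <= t <= f (2 * x) -> f (g t) = t).
  { intros t Ht.
    destruct (f_interv_is_interv f (x / 2) (2 * x) t) as [s [Hs Hfs]].
    - lra.
    - exact Ht.
    - intros s Hs. apply Hcont. lra.
    - now rewrite <- Hfs, Hinv by lra. }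
  assert (Prf : forall a, g (f (x / 2)) <= a <= g (f (2 * x)) ->
                derivable_pt f a).
  { rewrite !Hinv by lra. intros a Ha. exists (df a).
    apply is_derive_Reals, Hd. lra. }
  assert (Hg : g (f (x / 2)) <= g (f x) <= g (f (2 * x)))
    by (rewrite !Hinv by lra; lra).
  assert (Heq : derive_pt f (g (f x)) (Prf (g (f x)) Hg) = df x).
  { apply derive_pt_eq_0, is_derive_Reals.
    rewrite Hinv at 1 by lra. now apply Hd. }
  apply is_derive_Reals.
  replace (/ df x) with (1 / derive_pt f (g (f x)) (Prf (g (f x)) Hg))
    by (rewrite Heq; unfold Rdiv; ring).
  apply (derivable_pt_lim_recip_interv f g (f (x / 2)) (f (2 * x))); try lra.
  - exact Hgc.
  - exact Hsurj.
  - rewrite Heq. specialize (Hpos x Hx). lra.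
Qed.

(** Inverting a primitive of [w] turns a curve parametrized by [zeta] into one
    parametrized by [tau], whatever the range of [tau] is: outside that range
    the new curve takes arbitrary values. *)
Lemma time_change {V : NormedModule R_AbsRing} (w : R -> R) (X G : R -> V) :
  (forall x, 0 < x -> continuous w x) ->
  (forall x, 0 < x -> 0 < w x) ->
  (forall x, 0 < x -> is_derive X x (scal (w x) (G x))) ->
  exists (tau : R -> R) (Y : R -> V), forall x, 0 < x ->
    is_derive tau x (w x) /\ Y (tau x) = X x /\ is_derive Y (tau x) (G x).
Proof.
  intros Hw Hpos HX.
  set (tau := fun x => RInt w 1 x).
  assert (Htau : forall x, 0 < x -> is_derive tau x (w x)).
  { intros x Hx. apply is_derive_RInt with (a := 1); [|now apply Hw].
    exists (mkposreal x Hx). intros y Hy.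
    assert (0 < y).
    { unfold ball in Hy; simpl in Hy. unfold AbsRing_ball, abs, minus, plus, opp in Hy.
      simpl in Hy. apply Rabs_def2 in Hy. lra. }
    apply RInt_correct, ex_RInt_continuous. intros z Hz. apply Hw.
    apply Rlt_le_trans with (2 := proj1 Hz). apply Rmin_glb_lt; lra. }
  assert (Hinc := strictly_increasing_of_derive tau w 0 Htau Hpos).
  set (inv := fun t => epsilon (inhabits 0) (fun x => 0 < x /\ tau x = t)).
  assert (Hinv : forall x, 0 < x -> inv (tau x) = x).
  { intros x Hx.
    destruct (epsilon_spec (inhabits 0) (fun y => 0 < y /\ tau y = tau x))
      as [H1 H2]; [now exists x|].
    change (epsilon _ _) with (inv (tau x)) in H1, H2.
    destruct (Rtotal_order (inv (tau x)) x) as [H|[H|H]]; [|exact H|].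
    - specialize (Hinc _ _ H1 H). lra.
    - specialize (Hinc _ _ Hx H). lra. }
  exists tau, (fun t => X (inv t)). intros x Hx.
  split; [now apply Htau|]. rewrite Hinv by exact Hx. split; [reflexivity|].
  replace (G x) with (scal (/ w x) (scal (w x) (G x))).
  - apply (is_derive_comp X inv).
    + rewrite Hinv by exact Hx. now apply HX.
    + exact (is_derive_inverse tau inv w Htau Hpos Hinv x Hx).
  - rewrite scal_assoc. unfold mult; simpl. specialize (Hpos x Hx).
    rewrite Rinv_l by lra. apply (scal_one (G x)).
Qed.

(** * Inverting D + a *)

(** The solution of [(D + a) y = f], [y 0 = 0], by variation of constants. *)
Definition relax (a : R) (f : R -> R) (s : R) : R :=
  exp (- (a * s)) * RInt (fun t => exp (a * t) * f t) 0 s.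

Lemma relax_0 a f : relax a f 0 = 0.
Proof. unfold relax. rewrite RInt_point. apply Rmult_0_r. Qed.

Lemma is_derive_relax (a : R) (f : R -> R) :
  (forall x, continuous f x) ->
  forall s, is_derive (relax a f) s (f s - a * relax a f s).
Proof.
  intros Hf s. unfold relax.
  assert (Hc : forall x, continuous (fun t => exp (a * t) * f t) x).
  { intro x. apply (continuous_mult (fun t => exp (a * t)) f); [|apply Hf].
    apply (ex_derive_continuous (fun t => exp (a * t))). auto_derive; auto. }
  assert (HI : is_derive (RInt (fun t => exp (a * t) * f t) 0) s
                 (exp (a * s) * f s)).
  { apply (is_derive_RInt (fun t => exp (a * t) * f t) _ 0 s); [|apply Hc].
    apply filter_forall. intro y.
    apply (RInt_correct (V := R_CompleteNormedModule)).
    apply (ex_RInt_continuous (V := R_CompleteNormedModule)).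
    intros z _. apply Hc. }
  assert (HE : is_derive (fun s => exp (- (a * s))) s (- a * exp (- (a * s)))).
  { auto_derive; auto. ring. }
  replace (f s - _) with
    (- a * exp (- (a * s)) * RInt (fun t => exp (a * t) * f t) 0 s +
     exp (- (a * s)) * (exp (a * s) * f s)).
  - apply (is_derive_mult (fun s => exp (- (a * s))) _ s _ _ HE HI).
    intros; apply Rmult_comm.
  - rewrite <- Rmult_assoc, <- exp_plus.
    replace (- (a * s) + a * s) with 0 by ring. rewrite exp_0. ring.
Qed.

Lemma continuous_relax (a : R) (f : R -> R) :
  (forall x, continuous f x) -> forall s, continuous (relax a f) s.
Proof.
  intros Hf s. apply (ex_derive_continuous (relax a f)).
  eexists. now apply is_derive_relax.
Qed.

(** The function [exp (a s) * h s] is nondecreasing. *)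
Lemma nonneg_of_relax_super (a : R) (h dh : R -> R) :
  (forall s, 0 <= s -> is_derive h s (dh s)) ->
  (forall s, 0 <= s -> 0 <= dh s + a * h s) ->
  0 <= h 0 -> forall s, 0 <= s -> 0 <= h s.
Proof.
  intros Hd Hpos H0 s Hs.
  destruct (MVT_gen (fun t => exp (a * t) * h t) 0 s
              (fun t => exp (a * t) * (dh t + a * h t))) as [z [Hz Hf]].
  - rewrite Rmin_left, Rmax_right by lra. intros t Ht.
    replace (exp (a * t) * (dh t + a * h t)) with
      (a * exp (a * t) * h t + exp (a * t) * dh t) by ring.
    apply (is_derive_mult (fun t => exp (a * t)) h).
    + auto_derive; auto. ring.
    + apply Hd; lra.
    + intros; apply Rmult_comm.
  - rewrite Rmin_left, Rmax_right by lra. intros t Ht.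
    apply continuity_pt_filterlim.
    apply (continuous_mult (fun t => exp (a * t)) h).
    + apply (ex_derive_continuous (fun t => exp (a * t))). auto_derive; auto.
    + apply (ex_derive_continuous h). exists (dh t). apply Hd. lra.
  - rewrite Rmin_left, Rmax_right in Hz by lra.
    rewrite Rmult_0_r, exp_0, Rmult_1_l, Rminus_0_r in Hf.
    assert (0 <= exp (a * s) * h s).
    { assert (0 <= exp (a * z) * (dh z + a * h z)).
      { apply Rmult_le_pos; [apply Rlt_le, exp_pos|apply Hpos; lra]. }
      assert (0 <= exp (a * z) * (dh z + a * h z) * s)
        by (now apply Rmult_le_pos). lra. }
    assert (He := exp_pos (a * s)).
    apply Rmult_le_reg_l with (1 := He). lra.
Qed.

(** The comparison principle on which all estimates of [relax] rest. *)
Lemma relax_le_super (a : R) (f : R -> R) (h dh : R -> R) :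
  (forall x, continuous f x) ->
  (forall s, 0 <= s -> is_derive h s (dh s)) ->
  (forall s, 0 <= s -> f s <= dh s + a * h s) ->
  0 <= h 0 -> forall s, 0 <= s -> relax a f s <= h s.
Proof.
  intros Hf Hd Hle H0 s Hs.
  enough (0 <= h s - relax a f s) by lra.
  apply (nonneg_of_relax_super a (fun s => h s - relax a f s)
           (fun s => dh s - (f s - a * relax a f s))); auto.
  - intros t Ht. apply (is_derive_minus h (relax a f)).
    + now apply Hd.
    + now apply is_derive_relax.
  - intros t Ht. specialize (Hle t Ht). lra.
  - rewrite relax_0. lra.
Qed.

Lemma relax_ge_sub (a : R) (f : R -> R) (h dh : R -> R) :
  (forall x, continuous f x) ->
  (forall s, 0 <= s -> is_derive h s (dh s)) ->
  (forall s, 0 <= s -> dh s + a * h s <= f s) ->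
  h 0 <= 0 -> forall s, 0 <= s -> h s <= relax a f s.
Proof.
  intros Hf Hd Hle H0 s Hs.
  enough (0 <= relax a f s - h s) by lra.
  apply (nonneg_of_relax_super a (fun s => relax a f s - h s)
           (fun s => (f s - a * relax a f s) - dh s)); auto.
  - intros t Ht. apply (is_derive_minus (relax a f) h).
    + now apply is_derive_relax.
    + now apply Hd.
  - intros t Ht. specialize (Hle t Ht). lra.
  - rewrite relax_0. lra.
Qed.

Lemma relax_nonneg (a : R) (f : R -> R) :
  (forall x, continuous f x) -> (forall s, 0 <= s -> 0 <= f s) ->
  forall s, 0 <= s -> 0 <= relax a f s.
Proof.
  intros Hf Hpos. apply (relax_ge_sub a f (fun _ => 0) (fun _ => 0)); auto.
  - intros s _. apply (is_derive_const (V := R_NormedModule) 0 s).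
  - intros s Hs. specialize (Hpos s Hs). lra.
  - lra.
Qed.

Lemma relax_le_scale (a : R) (f g : R -> R) (k : R) :
  (forall x, continuous f x) -> (forall x, continuous g x) ->
  (forall s, 0 <= s -> f s <= k * g s) ->
  forall s, 0 <= s -> relax a f s <= k * relax a g s.
Proof.
  intros Hf Hg Hle.
  apply (relax_le_super a f (fun s => k * relax a g s)
           (fun s => k * (g s - a * relax a g s))); auto.
  - intros s Hs. apply (is_derive_scal (relax a g) s k).
    now apply is_derive_relax.
  - intros s Hs. specialize (Hle s Hs). lra.
  - rewrite relax_0. lra.
Qed.

Lemma relax_pos (a : R) (f : R -> R) :
  (forall x, continuous f x) -> (forall s, 0 < s -> 0 < f s) ->
  forall s, 0 < s -> 0 < relax a f s.
Proof.
  intros Hf Hpos s Hs. apply Rmult_lt_0_compat; [apply exp_pos|].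
  apply RInt_gt_0; [exact Hs| |].
  - intros x Hx. apply Rmult_lt_0_compat; [apply exp_pos|apply Hpos; lra].
  - intros x Hx. apply (continuous_mult (fun t => exp (a * t)) f); [|apply Hf].
    apply (ex_derive_continuous (fun t => exp (a * t))). auto_derive; auto.
Qed.

(** Two-sided comparison around the constant [l], the value at which [relax]
    rests under the constant forcing [a * l].  The condition at [0] is there
    because [relax] starts from [0], at distance [|l|]. *)
Lemma relax_close (a : R) (f : R -> R) (l : R) (h dh : R -> R) : a <> 0 ->
  (forall x, continuous f x) ->
  (forall s, 0 <= s -> is_derive h s (dh s)) ->
  (forall s, 0 <= s -> Rabs (f s - a * l) <= dh s + a * h s) ->
  Rabs l <= h 0 -> forall s, 0 <= s -> Rabs (relax a f s - l) <= h s.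
Proof.
  intros Ha Hf Hd Hle H0 s Hs.
  apply Rabs_le_between in H0.
  apply Rabs_le. split.
  - enough (l - h s <= relax a f s) by lra.
    apply (relax_ge_sub a f (fun s => l - h s) (fun s => 0 - dh s)); auto.
    + intros t Ht. apply (is_derive_minus (fun _ => l) h).
      * apply (is_derive_const (V := R_NormedModule) l t).
      * now apply Hd.
    + intros t Ht. specialize (Hle t Ht). apply Rabs_le_between in Hle. lra.
    + lra.
  - enough (relax a f s <= l + h s) by lra.
    apply (relax_le_super a f (fun s => l + h s) (fun s => 0 + dh s)); auto.
    + intros t Ht. apply (is_derive_plus (fun _ => l) h).
      * apply (is_derive_const (V := R_NormedModule) l t).
      * now apply Hd.
    + intros t Ht. specialize (Hle t Ht). apply Rabs_le_between in Hle. lra.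
    + lra.
Qed.

Lemma relax_le_add (a e : R) (f g : R -> R) : 0 < a -> 0 <= e ->
  (forall x, continuous f x) -> (forall x, continuous g x) ->
  (forall s, 0 <= s -> f s <= g s + e) ->
  forall s, 0 <= s -> relax a f s <= relax a g s + e / a.
Proof.
  intros Ha He Hf Hg H.
  apply (relax_le_super a f (fun s => relax a g s + e / a)
           (fun s => g s - a * relax a g s + 0)); auto.
  - intros s _. apply (is_derive_plus (relax a g) (fun _ => e / a)).
    + now apply is_derive_relax.
    + apply (is_derive_const (V := R_NormedModule) (e / a) s).
  - intros s Hs. specialize (H s Hs).
    replace (a * (relax a g s + e / a)) with (a * relax a g s + e)
      by (field; lra). lra.
  - rewrite relax_0. assert (0 <= e / a) by (apply Rdiv_le_0_compat; lra). lra.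
Qed.

Lemma relax_dist (a e : R) (f g : R -> R) : 0 < a -> 0 <= e ->
  (forall x, continuous f x) -> (forall x, continuous g x) ->
  (forall s, 0 <= s -> Rabs (f s - g s) <= e) ->
  forall s, 0 <= s -> Rabs (relax a f s - relax a g s) <= e / a.
Proof.
  intros Ha He Hf Hg H s Hs.
  assert (H1 := relax_le_add a e f g Ha He Hf Hg).
  assert (H2 := relax_le_add a e g f Ha He Hg Hf).
  apply Rabs_le. split.
  - enough (relax a g s <= relax a f s + e / a) by lra. apply H2; [|exact Hs].
    intros t Ht. specialize (H t Ht). apply Rabs_le_between in H. lra.
  - enough (relax a f s <= relax a g s + e / a) by lra. apply H1; [|exact Hs].
    intros t Ht. specialize (H t Ht). apply Rabs_le_between in H. lra.
Qed.

(** * Powers with exponent at most one *)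

(** [Rpower 0 al] is [1]; this is the continuous power on the half-line. *)
Definition pw (al x : R) : R := if Rle_dec x 0 then 0 else Rpower x al.

Lemma pw_pos_eq (al x : R) : 0 < x -> pw al x = Rpower x al.
Proof. intro Hx. unfold pw. destruct (Rle_dec x 0); [lra|reflexivity]. Qed.

Lemma pw_nonneg (al x : R) : 0 <= pw al x.
Proof.
  unfold pw. destruct (Rle_dec x 0); [lra|]. apply Rlt_le, exp_pos.
Qed.

Lemma exp_increasing_le (x y : R) : x <= y -> exp x <= exp y.
Proof.
  intros [H | ->]; [left; now apply exp_increasing|apply Rle_refl].
Qed.

Lemma Rpower_between (al t : R) : 0 <= al <= 1 -> 0 < t ->
  (1 <= t -> 1 <= Rpower t al <= t) /\ (t <= 1 -> t <= Rpower t al <= 1).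
Proof.
  intros Hal Ht. split; intro H1.
  - split.
    + rewrite <- (Rpower_O t) at 1 by exact Ht. apply Rle_Rpower; lra.
    + rewrite <- (Rpower_1 t) at 2 by exact Ht. apply Rle_Rpower; lra.
  - assert (Hln : ln t <= 0) by (rewrite <- ln_1; apply ln_le; lra).
    unfold Rpower. split.
    + rewrite <- (exp_ln t) at 1 by exact Ht. apply exp_increasing_le. nra.
    + rewrite <- exp_0. apply exp_increasing_le. nra.
Qed.

Lemma Rpower_pos (x al : R) : 0 < Rpower x al.
Proof. apply exp_pos. Qed.

Lemma Rpower_factor (al x x0 : R) : 0 < x -> 0 < x0 ->
  Rpower x al = Rpower x0 al * Rpower (x / x0) al.
Proof.
  intros Hx H0. rewrite Rpower_mult_distr; auto.
  - f_equal. field. lra.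
  - now apply Rdiv_lt_0_compat.
Qed.

(** Since [t ^ al] lies between [1] and [t], the relative variation of
    [x ^ al] is at most that of [x]. *)
Lemma pw_close (al x x0 : R) : 0 <= al <= 1 -> 0 < x0 -> 0 <= x ->
  Rabs (pw al x - Rpower x0 al) <= Rpower x0 al / x0 * Rabs (x - x0).
Proof.
  intros Hal H0 Hx. assert (HP := Rpower_pos x0 al).
  assert (HPx : 0 < Rpower x0 al / x0) by now apply Rdiv_lt_0_compat.
  destruct (Req_dec x 0) as [->|Hne].
  - unfold pw. destruct (Rle_dec 0 0); [|lra].
    rewrite !(Rabs_minus_sym 0), !Rminus_0_r, !Rabs_pos_eq by lra.
    apply Req_le. field. lra.
  - rewrite pw_pos_eq, (Rpower_factor al x x0) by lra.
    destruct (Rpower_between al (x / x0)) as [Hge Hle]; auto.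
    { apply Rdiv_lt_0_compat; lra. }
    assert (Hq : x = x / x0 * x0) by (field; lra).
    replace (Rpower x0 al * Rpower (x / x0) al - Rpower x0 al)
      with (Rpower x0 al * (Rpower (x / x0) al - 1)) by ring.
    replace (x - x0) with (x0 * (x / x0 - 1)) by (field; lra).
    rewrite !Rabs_mult, !(Rabs_pos_eq (Rpower x0 al)), (Rabs_pos_eq x0) by lra.
    replace (Rpower x0 al / x0 * (x0 * Rabs (x / x0 - 1)))
      with (Rpower x0 al * Rabs (x / x0 - 1)) by (field; lra).
    apply Rmult_le_compat_l; [lra|].
    destruct (Rle_dec 1 (x / x0)).
    + rewrite !Rabs_pos_eq; lra.
    + rewrite !Rabs_left1; lra.
Qed.

(** Subhomogeneity: the power amplifies ratios no more than the identity. *)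
Lemma pw_le_scale (al k x y : R) : 0 <= al <= 1 -> 1 <= k -> 0 <= y ->
  x <= k * y -> pw al x <= k * pw al y.
Proof.
  intros Hal Hk Hy Hxy.
  destruct (Rle_dec x 0) as [Hx|Hx].
  - assert (Hn := pw_nonneg al y). unfold pw at 1.
    destruct (Rle_dec x 0) as [_|]; [|lra].
    apply Rmult_le_pos; lra.
  - assert (0 < y) by nra. rewrite !pw_pos_eq by lra.
    apply Rle_trans with (Rpower (k * y) al).
    + apply Rle_Rpower_l; lra.
    + rewrite <- Rpower_mult_distr by lra.
      apply Rmult_le_compat_r; [apply Rlt_le, Rpower_pos|].
      destruct (Rpower_between al k) as [Hb _]; lra.
Qed.

(** Away from [0] this is [pw_close]; at [0] the modulus of continuity is
    [eps ^ (1 / al)]. *)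
Lemma continuous_pw (al x : R) : 0 < al <= 1 -> continuous (pw al) x.
Proof.
  intro Hal. apply filterlim_locally. intros [eps Heps].
  destruct (Rtotal_order x 0) as [Hx|[->|Hx]].
  - assert (Hd : 0 < - x) by lra. exists (mkposreal _ Hd).
    intros y Hy. change (Rabs (y - x) < - x) in Hy. apply Rabs_def2 in Hy.
    change (Rabs (pw al y - pw al x) < eps). unfold pw. destruct (Rle_dec y 0) as [_|]; [|lra].
    destruct (Rle_dec x 0) as [_|]; [|lra].
    rewrite Rminus_0_r, Rabs_R0. exact Heps.
  - exists (mkposreal (Rpower eps (/ al)) (Rpower_pos _ _)).
    intros y Hy. change (Rabs (y - 0) < Rpower eps (/ al)) in Hy.
    change (Rabs (pw al y - pw al 0) < eps).
    unfold pw at 2. destruct (Rle_dec 0 0) as [_|]; [|lra]. rewrite Rminus_0_r in *.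
    rewrite Rabs_pos_eq by apply pw_nonneg.
    unfold pw. destruct (Rle_dec y 0) as [|Hy0]; [exact Heps|].
    rewrite Rabs_pos_eq in Hy by lra.
    replace eps with (Rpower (Rpower eps (/ al)) al).
    + apply Rlt_Rpower_l; lra.
    + rewrite Rpower_mult, Rinv_l by lra. now apply Rpower_1.
  - assert (HP : 0 < Rpower x al / x)
      by (apply Rdiv_lt_0_compat; [apply Rpower_pos|exact Hx]).
    assert (Hd : 0 < Rmin x (eps / (Rpower x al / x)))
      by (apply Rmin_glb_lt; [exact Hx|now apply Rdiv_lt_0_compat]).
    exists (mkposreal _ Hd). intros y Hy.
    change (Rabs (y - x) < Rmin x (eps / (Rpower x al / x))) in Hy.
    change (Rabs (pw al y - pw al x) < eps). assert (H1 := Rmin_l x (eps / (Rpower x al / x))).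
    assert (H2 := Rmin_r x (eps / (Rpower x al / x))).
    rewrite (pw_pos_eq al x) by exact Hx.
    apply Rle_lt_trans with (Rpower x al / x * Rabs (y - x)).
    + assert (Hy' := Hy). apply Rabs_def2 in Hy'. apply pw_close; lra.
    + replace eps with (Rpower x al / x * (eps / (Rpower x al / x)))
        by (field; split; [lra|apply Rgt_not_eq, Rpower_pos]).
      apply Rmult_lt_compat_l; lra.
Qed.

(** * Limits of geometrically convergent sequences *)

(** Adding and subtracting the tail of the geometric series turns the
    sequence into two monotone ones enclosing it. *)
Lemma geometric_lim (u : nat -> R) (K th : R) : 0 <= th < 1 ->
  (forall n, Rabs (u (S n) - u n) <= K * th ^ n) ->
  forall n, Rabs (u n - real (Lim_seq u)) <= K / (1 - th) * th ^ n.
Proof.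
  intros Hth Hu.
  set (e := fun n => K / (1 - th) * th ^ n).
  assert (He : forall n, e n - e (S n) = K * th ^ n).
  { intro n. unfold e. simpl. field. lra. }
  assert (He0 : is_lim_seq e 0).
  { replace (Finite 0) with (Rbar_mult (K / (1 - th)) 0)
      by (simpl; f_equal; ring).
    apply is_lim_seq_scal_l, is_lim_seq_geom.
    rewrite Rabs_pos_eq; lra. }
  assert (Hdec : forall n, u (S n) + e (S n) <= u n + e n).
  { intro n. specialize (Hu n). specialize (He n).
    apply Rabs_le_between in Hu. lra. }
  assert (Hinc : forall n, u n - e n <= u (S n) - e (S n)).
  { intro n. specialize (Hu n). specialize (He n).
    apply Rabs_le_between in Hu. lra. }
  assert (Hnonneg : forall n, 0 <= e n).
  { intro n. unfold e. apply Rmult_le_pos; [|apply pow_le; lra].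
    assert (0 <= K).
    { specialize (Hu 0%nat). simpl in Hu.
      assert (Hp := Rabs_pos (u 1%nat - u 0%nat)). lra. }
    apply Rdiv_le_0_compat; lra. }
  assert (Hlow : forall n, u 0%nat - e 0%nat <= u n - e n).
  { induction n; [lra|]. specialize (Hinc n). lra. }
  destruct (ex_finite_lim_seq_decr (fun n => u n + e n) (u 0%nat - e 0%nat))
    as [l Hl]; [exact Hdec| |].
  { intro n. specialize (Hlow n). specialize (Hnonneg n). lra. }
  assert (Hul : is_lim_seq u l).
  { apply is_lim_seq_ext with (fun n => (u n + e n) - e n); [intro; ring|].
    replace (Finite l) with (Finite (l - 0)) by (f_equal; ring).
    now apply is_lim_seq_minus'. }
  intro n. rewrite (is_lim_seq_unique _ _ Hul). simpl.
  assert (H1 := is_lim_seq_decr_compare _ _ Hl Hdec n).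
  assert (Hl2 : is_lim_seq (fun n => u n - e n) l).
  { replace (Finite l) with (Finite (l - 0)) by (f_equal; ring).
    now apply is_lim_seq_minus'. }
  assert (H2 := is_lim_seq_incr_compare _ _ Hl2 Hinc n).
  cbv beta in H1, H2. fold (e n). apply Rabs_le. lra.
Qed.

Lemma is_lim_seq_of_error (u e : nat -> R) (l : R) :
  (forall n, Rabs (u n - l) <= e n) -> is_lim_seq e 0 -> is_lim_seq u l.
Proof.
  intros H He.
  apply is_lim_seq_le_le with (fun n => l - e n) (fun n => l + e n).
  - intro n. specialize (H n). apply Rabs_le_between in H. lra.
  - replace (Finite l) with (Finite (l - 0)) by (f_equal; ring).
    apply is_lim_seq_minus'; [apply is_lim_seq_const|exact He].
  - replace (Finite l) with (Finite (l + 0)) by (f_equal; ring).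
    apply is_lim_seq_plus'; [apply is_lim_seq_const|exact He].
Qed.

Lemma continuous_unif_lim (fn : nat -> R -> R) (f : R -> R) :
  (forall n x, continuous (fn n) x) ->
  (forall eps, 0 < eps -> exists n, forall x, Rabs (fn n x - f x) <= eps) ->
  forall x, continuous f x.
Proof.
  intros Hc Hu x. apply filterlim_locally. intros [eps Heps].
  destruct (Hu (eps / 4)) as [n Hn]; [lra|].
  assert (He : 0 < eps / 4) by lra.
  generalize (proj1 (filterlim_locally _ _) (Hc n x) (mkposreal _ He)).
  apply filter_imp. intros y Hy.
  change (Rabs (fn n y - fn n x) < eps / 4) in Hy.
  change (Rabs (f y - f x) < eps).
  assert (H1 := Hn x). assert (H2 := Hn y).
  apply Rabs_def2 in Hy. apply Rabs_le_between in H1, H2.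
  apply Rabs_def1; lra.
Qed.

(** * A decaying supersolution *)

(** The equation [(D + a)^2 e = (A + k exp (- a s)) (P / rR) e + k P exp (- a s)]
    bounds the distance to the rest point.  Its coefficients settle at values for
    which solutions decay, since [A P / rR = a^2 - B / rR < a^2], but may first
    let them grow.  The factor [exp (N (1 - exp (- a s)))], bounded, pays for
    that transient: it contributes about [a^2 N exp (- a s)] to [(D + a)^2]. *)
Lemma decaying_supersolution (a B A rR P k : R) :
  0 < a -> 0 < B -> 0 < rR -> 0 < P -> 0 <= k ->
  a * (a * rR) = B + A * P ->
  exists (Phi0 Phi1 Phi2 : R -> R) (b K : R),
    0 < b /\
    (forall s, is_derive Phi0 s (Phi1 s - a * Phi0 s)) /\
    (forall s, is_derive Phi1 s (Phi2 s - a * Phi1 s)) /\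
    rR <= Phi0 0 /\ a * rR <= Phi1 0 /\
    forall s, 0 <= s ->
      0 <= Phi0 s /\
      (A + k * exp (- (a * s))) * (P / rR) * Phi0 s + k * exp (- (a * s)) * P
        <= Phi2 s /\
      Phi0 s <= K * exp (- (b * s)) /\ Phi1 s <= K * exp (- (b * s)) /\
      Phi2 s <= K.
Proof.
  intros Ha HB HrR HP Hk Heq.
  (* with this rate, (a - b)^2 exceeds a^2 - B / rR by at least B / (2 rR) *)
  set (b := Rmin (B / (4 * a * rR)) (a / 4)).
  assert (Hb1 : b <= B / (4 * a * rR)) by apply Rmin_l.
  assert (Hb2 : b <= a / 4) by apply Rmin_r.
  assert (Hb : 0 < b).
  { apply Rmin_glb_lt; [apply Rdiv_lt_0_compat|]; try lra.
    apply Rmult_lt_0_compat; lra. }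
  assert (Hab : 2 * a * b <= B / (2 * rR)).
  { replace (B / (2 * rR)) with (2 * a * (B / (4 * a * rR))) by (field; lra).
    apply Rmult_le_compat_l; lra. }
  set (c := k * (P / rR)).
  assert (Hc : 0 <= c).
  { apply Rmult_le_pos; [exact Hk|]. apply Rlt_le, Rdiv_lt_0_compat; lra. }
  set (N := 2 * c / a ^ 2 + 1).
  assert (HN1 : 1 <= N).
  { assert (0 <= 2 * c / a ^ 2).
    { apply Rdiv_le_0_compat; [lra|]. now apply pow_lt. }
    unfold N; lra. }
  assert (HNc : 2 * c <= N * a ^ 2).
  { unfold N. replace ((2 * c / a ^ 2 + 1) * a ^ 2) with (2 * c + a ^ 2)
      by (field; lra). assert (H := pow2_ge_0 a). lra. }
  (* the second term lets the excess B / (2 rR) absorb the source *)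
  set (D := rR + 2 * rR * k * P / B).
  assert (HDr : rR <= D).
  { assert (0 <= 2 * rR * k * P / B).
    { apply Rdiv_le_0_compat; [|lra]. repeat apply Rmult_le_pos; lra. }
    unfold D; lra. }
  assert (HDk : k * P <= D * (B / (2 * rR))).
  { unfold D. replace ((rR + 2 * rR * k * P / B) * (B / (2 * rR)))
      with (k * P + B / 2) by (field; lra). lra. }
  set (E := fun s => exp (- (a * s))).
  (* Phi0' = (w - a) Phi0 *)
  set (w := fun s => a - b + N * a * E s).
  set (Phi0 := fun s => D * exp (- b * s + N * (1 - E s))).
  assert (HE : forall s, 0 <= s -> 0 < E s <= 1 /\ E s <= exp (- (b * s))).
  { intros s Hs. split; [split; [apply exp_pos|]|].
    - unfold E. rewrite <- exp_0. apply exp_increasing_le. nra.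
    - apply exp_increasing_le. nra. }
  assert (HP0 : forall s, 0 <= s ->
            D * exp (- (b * s)) <= Phi0 s <= D * exp N * exp (- (b * s))).
  { intros s Hs. destruct (HE s Hs) as [H1 _]. unfold Phi0.
    rewrite Rmult_assoc, <- exp_plus.
    split; (apply Rmult_le_compat_l; [lra|]; apply exp_increasing_le; nra). }
  assert (HDe : 0 < D * exp N) by (apply Rmult_lt_0_compat; [lra|apply exp_pos]).
  set (W := a + N * a).
  assert (HW : 1 * a <= W) by (unfold W; nra).
  assert (Hw : forall s, 0 <= s -> 0 < w s <= W).
  { intros s Hs. destruct (HE s Hs) as [[H1 H2] _]. unfold w, W.
    assert (0 < N * a) by (apply Rmult_lt_0_compat; lra).
    assert (0 < N * a * E s) by (now apply Rmult_lt_0_compat).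
    assert (N * a * E s <= N * a * 1) by (apply Rmult_le_compat_l; lra). lra. }
  exists Phi0, (fun s => w s * Phi0 s),
    (fun s => (w s ^ 2 - N * a ^ 2 * E s) * Phi0 s), b,
    ((1 + W + W ^ 2) * (D * exp N)).
  split; [exact Hb|]. split; [|split; [|split; [|split]]].
  - intro s. unfold Phi0, w, E. auto_derive; auto.
    unfold Rminus. ring.
  - intro s. unfold Phi0, w, E. auto_derive; auto.
    unfold Rminus. ring.
  - unfold Phi0, E. rewrite !Rmult_0_r, Ropp_0, exp_0.
    replace (0 + N * (1 - 1)) with 0 by ring. rewrite exp_0. lra.
  - unfold Phi0, w, E. rewrite !Rmult_0_r, Ropp_0, exp_0.
    replace (0 + N * (1 - 1)) with 0 by ring. rewrite exp_0.
    rewrite !Rmult_1_r. apply Rmult_le_compat; nra.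
  - intros s Hs. fold (E s).
    destruct (HE s Hs) as [[HE0 HE1] HEb]. destruct (HP0 s Hs) as [Hlo Hup].
    destruct (Hw s Hs) as [Hw0 HwW].
    assert (Hexp := exp_pos (- (b * s))).
    assert (Hphi : 0 < Phi0 s).
    { apply Rlt_le_trans with (2 := Hlo). apply Rmult_lt_0_compat; lra. }
    assert (HEs : D * E s <= Phi0 s).
    { apply Rle_trans with (2 := Hlo). apply Rmult_le_compat_l; lra. }
    assert (HW2 : 0 <= W ^ 2) by apply pow2_ge_0.
    assert (Hbig : 0 <= D * exp N * exp (- (b * s)))
      by (apply Rmult_le_pos; lra).
    split; [lra|]. split; [|split; [|split]].
    + assert (HAP : A * (P / rR) = a ^ 2 - B / rR).
      { replace (A * (P / rR)) with ((a * (a * rR) - B) / rR)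
          by (rewrite Heq; field; lra). field; lra. }
      replace ((A + k * E s) * (P / rR) * Phi0 s)
        with ((A * (P / rR) + c * E s) * Phi0 s) by (unfold c; ring).
      rewrite HAP.
      assert (Hsrc : k * E s * P <= B / (2 * rR) * Phi0 s).
      { apply Rle_trans with (B / (2 * rR) * (D * E s)).
        - replace (k * E s * P) with (k * P * E s) by ring.
          replace (B / (2 * rR) * (D * E s)) with (D * (B / (2 * rR)) * E s)
            by ring. apply Rmult_le_compat_r; lra.
        - apply Rmult_le_compat_l; [|exact HEs].
          apply Rlt_le, Rdiv_lt_0_compat; lra. }
      assert (HBr : B / rR = 2 * (B / (2 * rR))) by (field; lra).
      assert (Hcoef : a ^ 2 - B / rR + c * E s + B / (2 * rR)
                      <= w s ^ 2 - N * a ^ 2 * E s).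
      { assert (H1 : c * E s <= N * a ^ 2 / 2 * E s)
          by (apply Rmult_le_compat_r; lra).
        assert (H2 : 0 <= (N * a * E s) ^ 2) by apply pow2_ge_0.
        assert (H3 : 0 <= N * a * E s * (a / 2 - 2 * b)).
        { apply Rmult_le_pos; [|lra].
          apply Rlt_le; repeat apply Rmult_lt_0_compat; lra. }
        assert (H4 := pow2_ge_0 b). unfold w. nra. }
      apply Rle_trans with ((a ^ 2 - B / rR + c * E s + B / (2 * rR)) * Phi0 s).
      * lra.
      * apply Rmult_le_compat_r; lra.
    + rewrite Rmult_assoc.
      assert (0 <= W * (D * exp N * exp (- (b * s)))) by (apply Rmult_le_pos; lra).
      assert (0 <= W ^ 2 * (D * exp N * exp (- (b * s))))
        by (apply Rmult_le_pos; lra). lra.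
    + rewrite Rmult_assoc.
      assert (w s * Phi0 s <= W * (D * exp N * exp (- (b * s))))
        by (apply Rmult_le_compat; lra).
      assert (0 <= W ^ 2 * (D * exp N * exp (- (b * s))))
        by (apply Rmult_le_pos; lra). lra.
    + assert (Hle1 : exp (- (b * s)) <= 1)
        by (rewrite <- exp_0; apply exp_increasing_le; nra).
      assert (Hphi1 : Phi0 s <= D * exp N) by nra.
      apply Rle_trans with (W ^ 2 * (D * exp N)).
      * apply Rle_trans with (W ^ 2 * Phi0 s).
        -- apply Rmult_le_compat_r; [lra|].
           assert (w s ^ 2 <= W ^ 2) by (apply pow_incr; lra).
           assert (0 <= N * a ^ 2 * E s).
           { assert (Ha2 := pow2_ge_0 a). repeat apply Rmult_le_pos; lra. }
           lra.
        -- apply Rmult_le_compat_l; lra.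
      * assert (0 <= W * (D * exp N)) by (apply Rmult_le_pos; lra). lra.
Qed.

(** * The singular second-order equation *)

(** A fixed point [f] of [force_step] is the right-hand side of
    [(D + a)^2 r = B + g r^al] along the solution [r = relax a (relax a f)] with
    [r 0 = r' 0 = 0].  Only its values at [s >= 0] matter; the even extension
    makes it continuous on the whole line, so that its iterates are
    integrable, and differentiable after [relax], at [0] as well. *)
Definition force_step (a B al : R) (g f : R -> R) (s : R) : R :=
  B + g (Rabs s) * pw al (relax a (relax a f) (Rabs s)).

Lemma continuous_force_step (a B al : R) (g f : R -> R) : 0 < al <= 1 ->
  (forall x, 0 <= x -> continuous g x) -> (forall x, continuous f x) ->
  forall x, continuous (force_step a B al g f) x.
Proof.
  intros Hal Hg Hf x. unfold force_step.
  apply (continuous_plus (fun _ => B)); [apply continuous_const|].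
  apply (continuous_mult (fun s => g (Rabs s))).
  - apply continuous_comp; [apply continuous_Rabs|apply Hg, Rabs_pos].
  - apply (continuous_comp (fun s => relax a (relax a f) (Rabs s)) (pw al)).
    + apply continuous_comp; [apply continuous_Rabs|].
      now apply continuous_relax; apply continuous_relax.
    + now apply continuous_pw.
Qed.

(** Scaling [f] by a factor at least one scales [g r^al] by at most that factor
    and leaves alone the constant [B], which makes up at least the fraction
    [B / M] of the result: the excess ratio between two arguments shrinks by the
    factor [1 - B / M].  Comparing ratios instead of differences avoids the
    infinite slope of [r^al] at [r = 0] for [al < 1]. *)
Lemma force_step_ratio (a B al M d : R) (g f1 f2 : R -> R) :
  0 < B -> 0 < M -> 0 < al <= 1 -> 0 <= d ->
  (forall x, 0 <= x -> 0 <= g x) ->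
  (forall x, continuous f1 x) -> (forall x, continuous f2 x) ->
  (forall x, 0 <= f2 x) ->
  (forall x, f1 x <= (1 + d) * f2 x) ->
  (forall x, force_step a B al g f2 x <= M) ->
  forall x, force_step a B al g f1 x
            <= (1 + (1 - B / M) * d) * force_step a B al g f2 x.
Proof.
  intros HB HM Hal Hd Hg Hc1 Hc2 H2 H12 Hle x. specialize (Hle x).
  assert (Hx := Rabs_pos x).
  assert (Hcr1 := continuous_relax a f1 Hc1).
  assert (Hcr2 := continuous_relax a f2 Hc2).
  assert (Hr : relax a (relax a f1) (Rabs x)
               <= (1 + d) * relax a (relax a f2) (Rabs x)).
  { apply relax_le_scale; auto. intros s Hs. apply relax_le_scale; auto. }
  assert (Hr2 : 0 <= relax a (relax a f2) (Rabs x)).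
  { apply relax_nonneg; auto. intros s Hs. apply relax_nonneg; auto. }
  assert (Hpw := pw_le_scale al (1 + d) _ _ (conj (Rlt_le _ _ (proj1 Hal)) (proj2 Hal))
                   ltac:(lra) Hr2 Hr).
  assert (H := Rmult_le_compat_l _ _ _ (Hg _ Hx) Hpw).
  apply Rle_trans with (force_step a B al g f2 x
                        + d * (force_step a B al g f2 x - B)).
  - unfold force_step. lra.
  - assert (B / M * force_step a B al g f2 x <= B).
    { apply Rle_trans with (B / M * M); [|right; field; lra].
      apply Rmult_le_compat_l; [|exact Hle]. apply Rlt_le, Rdiv_lt_0_compat; lra. }
    nra.
Qed.

Fixpoint force_iter (a B al : R) (g f0 : R -> R) (n : nat) : R -> R :=
  match n with
  | O => f0
  | S n => force_step a B al g (force_iter a B al g f0 n)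
  end.

(** Any two functions with values between [B] and [M] have ratio at most
    [M / B], and [force_step_ratio] improves this geometrically along the iteration. *)
Lemma force_iter_converges (a B al M : R) (g f0 : R -> R) :
  0 < a -> 0 < B -> 0 < al <= 1 ->
  (forall x, 0 <= x -> continuous g x) -> (forall x, 0 <= x -> 0 <= g x) ->
  (forall n x, continuous (force_iter a B al g f0 n) x) ->
  (forall n x, B <= force_iter a B al g f0 n x <= M) ->
  exists f : R -> R,
    (forall x, continuous f x) /\
    (forall x, f x = force_step a B al g f x) /\
    (forall x, is_lim_seq (fun n => force_iter a B al g f0 n x) (f x)).
Proof.
  intros Ha HB Hal Hgc Hg0 Hcn HnBM.
  set (fn := force_iter a B al g f0) in *.
  assert (HBM : B <= M) by (specialize (HnBM 0%nat 0); lra).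
  set (th := 1 - B / M).
  assert (Hth : 0 <= th < 1).
  { assert (0 < B / M <= 1).
    { split; [apply Rdiv_lt_0_compat; lra|].
      apply Rmult_le_reg_r with M; [lra|].
      replace (B / M * M) with B by (field; lra). lra. }
    unfold th. lra. }
  set (d := (M - B) / B).
  assert (Hd : 0 <= d) by (apply Rdiv_le_0_compat; lra).
  assert (Hratio : forall n x,
    fn (S n) x <= (1 + d * th ^ n) * fn n x /\
    fn n x <= (1 + d * th ^ n) * fn (S n) x).
  { induction n as [|n IH].
    - assert (H : forall x y, B <= x <= M -> B <= y <= M ->
                x <= (1 + d * th ^ 0) * y).
      { intros x y H1 H2. simpl. rewrite Rmult_1_r.
        apply Rle_trans with ((1 + d) * B).
        - unfold d. replace ((1 + (M - B) / B) * B) with M by (field; lra). lra.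
        - apply Rmult_le_compat_l; lra. }
      intro x. split; apply H; apply HnBM.
    - assert (Hdn : 0 <= d * th ^ n).
      { apply Rmult_le_pos; [exact Hd|]. apply pow_le. lra. }
      assert (H0 : forall m x, 0 <= fn m x)
        by (intros m x; specialize (HnBM m x); lra).
      assert (HM : forall m x, fn m x <= M) by (intros m x; apply HnBM).
      replace (d * th ^ S n) with ((1 - B / M) * (d * th ^ n))
        by (unfold th; simpl; ring).
      intro x. split.
      + apply (force_step_ratio a B al M _ g (fn (S n)) (fn n)); auto; try lra.
        * intro y. apply IH.
        * apply (HM (S n)).
      + apply (force_step_ratio a B al M _ g (fn n) (fn (S n))); auto; try lra.
        * intro y. apply IH.
        * apply (HM (S (S n))). }
  assert (Hcauchy : forall n x, Rabs (fn (S n) x - fn n x) <= M * d * th ^ n).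
  { intros n x. destruct (Hratio n x) as [H1 H2].
    assert (Hdn : 0 <= d * th ^ n).
    { apply Rmult_le_pos; [exact Hd|]. apply pow_le. lra. }
    assert (H3 := Rmult_le_compat_l _ _ _ Hdn (proj2 (HnBM n x))).
    assert (H4 := Rmult_le_compat_l _ _ _ Hdn (proj2 (HnBM (S n) x))).
    apply Rabs_le. lra. }
  set (f := fun x => real (Lim_seq (fun n => fn n x))).
  set (C := M * d / (1 - th)).
  assert (Hlim : forall n x, Rabs (fn n x - f x) <= C * th ^ n).
  { intros n x. now apply (geometric_lim (fun n => fn n x)). }
  assert (HC0 : is_lim_seq (fun n => C * th ^ n) 0).
  { replace (Finite 0) with (Rbar_mult C 0) by (simpl; f_equal; ring).
    apply is_lim_seq_scal_l, is_lim_seq_geom. rewrite Rabs_pos_eq; lra. }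
  assert (Hptf : forall x, is_lim_seq (fun n => fn n x) (f x)).
  { intro x. now apply (is_lim_seq_of_error _ (fun n => C * th ^ n)). }
  assert (Hfc : forall x, continuous f x).
  { apply (continuous_unif_lim fn).
    - exact Hcn.
    - intros eps Heps. apply is_lim_seq_spec in HC0.
      destruct (HC0 (mkposreal eps Heps)) as [n Hn]. exists n. intro x.
      specialize (Hn n (Nat.le_refl n)). simpl in Hn.
      rewrite Rminus_0_r in Hn. apply Rabs_def2 in Hn.
      specialize (Hlim n x). lra. }
  exists f. split; [exact Hfc|]. split; [|exact Hptf]. intro x.
  assert (Hr : is_lim_seq (fun n => relax a (relax a (fn n)) (Rabs x))
                 (relax a (relax a f) (Rabs x))).
  { apply (is_lim_seq_of_error _ (fun n => 1 / a / a * (C * th ^ n))).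
    - intro n.
      assert (HCn : 0 <= C * th ^ n).
      { apply Rle_trans with (2 := Hlim n 0). apply Rabs_pos. }
      replace (1 / a / a * (C * th ^ n)) with (C * th ^ n / a / a)
        by (field; lra).
      apply relax_dist; auto.
      + apply Rdiv_le_0_compat; lra.
      + apply continuous_relax, Hcn.
      + now apply continuous_relax.
      + intros y Hy. apply relax_dist; auto.
      + apply Rabs_pos.
    - replace (Finite 0) with (Rbar_mult (1 / a / a) 0)
        by (simpl; f_equal; ring).
      now apply is_lim_seq_scal_l. }
  assert (Hs : is_lim_seq (fun n => fn (S n) x) (force_step a B al g f x)).
  { unfold fn. simpl. unfold force_step. fold fn.
    apply (is_lim_seq_plus' (fun _ => B)); [apply is_lim_seq_const|].
    apply (is_lim_seq_scal_l _ (g (Rabs x)) (pw al _)).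
    apply (is_lim_seq_continuous (pw al)); [|exact Hr].
    apply continuity_pt_filterlim. now apply (continuous_pw al). }
  assert (Hs' := proj1 (is_lim_seq_incr_1 _ _) (Hptf x)).
  apply is_lim_seq_unique in Hs. apply is_lim_seq_unique in Hs'.
  rewrite Hs in Hs'. now injection Hs'.
Qed.

(** The iteration starts from the constant forcing of the rest point, so that the
    supersolution bounds the deviation of every iterate from the start on. *)
Lemma singular_oscillator (a B al A rR k : R) (g : R -> R) :
  0 < a -> 0 < B -> 0 < al <= 1 -> 0 < A -> 0 < rR -> 0 <= k ->
  a * (a * rR) = B + A * Rpower rR al ->
  (forall x, 0 <= x -> continuous g x) ->
  (forall x, 0 <= x -> 0 <= g x) ->
  (forall x, 0 <= x -> Rabs (g x - A) <= k * exp (- (a * x))) ->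
  exists f : R -> R,
    (forall x, continuous f x) /\
    (forall x, f x = force_step a B al g f x) /\
    (forall x, B <= f x) /\
    exists b K, 0 < b /\ forall s, 0 <= s ->
      Rabs (relax a f s - a * rR) <= K * exp (- (b * s)) /\
      Rabs (relax a (relax a f) s - rR) <= K * exp (- (b * s)).
Proof.
  intros Ha HB Hal HA HrR Hk Heq Hgc Hg0 HgA.
  set (P := Rpower rR al) in *. assert (HP : 0 < P) by apply Rpower_pos.
  destruct (decaying_supersolution a B A rR P k)
    as (Phi0 & Phi1 & Phi2 & b & K & Hb & Hd0 & Hd1 & Hi0 & Hi1 & Hphi); auto.
  (* the band of width Phi2 around the rest value passes through both relaxations *)
  assert (Hband : forall f, (forall x, continuous f x) -> (forall x, 0 <= f x) ->
    (forall x, 0 <= x -> Rabs (f x - a * (a * rR)) <= Phi2 x) ->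
    forall s, 0 <= s ->
      0 <= relax a (relax a f) s /\
      Rabs (relax a f s - a * rR) <= Phi1 s /\
      Rabs (relax a (relax a f) s - rR) <= Phi0 s).
  { intros f Hc H0 Hf.
    assert (Hcr := continuous_relax a f Hc).
    assert (H1 : forall s, 0 <= s -> Rabs (relax a f s - a * rR) <= Phi1 s).
    { apply (relax_close a f (a * rR) Phi1 (fun s => Phi2 s - a * Phi1 s)); auto.
      - lra.
      - intros s Hs. specialize (Hf s Hs). lra.
      - rewrite Rabs_pos_eq; [exact Hi1|]. apply Rmult_le_pos; lra. }
    intros s Hs. split; [|split; [now apply H1|]].
    - apply relax_nonneg; auto. intros t Ht. apply relax_nonneg; auto.
    - revert s Hs.
      apply (relax_close a _ rR Phi0 (fun s => Phi1 s - a * Phi0 s)); auto.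
      + lra.
      + intros s Hs. specialize (H1 s Hs). lra.
      + rewrite Rabs_pos_eq; lra. }
  set (fn := force_iter a B al g (fun _ => a * (a * rR))).
  assert (Hinv : forall n, (forall x, continuous (fn n) x) /\
    (forall x, B <= fn n x) /\
    (forall x, Rabs (fn n x - a * (a * rR)) <= Phi2 (Rabs x))).
  { induction n as [|n [IHc [IHB IH]]].
    - split; [intro; apply continuous_const|]. split.
      + intro x. unfold fn. simpl. assert (0 < A * P) by (now apply Rmult_lt_0_compat). lra.
      + intro x. unfold fn. simpl. rewrite Rminus_diag, Rabs_R0.
        destruct (Hphi (Rabs x) (Rabs_pos x)) as (H0 & H2 & _).
        apply Rle_trans with (2 := H2).
        assert (HE := exp_pos (- (a * Rabs x))).
        assert (0 < P / rR) by (now apply Rdiv_lt_0_compat).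
        assert (0 <= k * exp (- (a * Rabs x))) by (apply Rmult_le_pos; lra).
        apply Rplus_le_le_0_compat; apply Rmult_le_pos; try lra.
        apply Rmult_le_pos; lra.
    - split; [now apply continuous_force_step|]. split.
      + intro x. unfold fn. simpl. unfold force_step. fold fn. fold (fn n).
        assert (0 <= g (Rabs x) * pw al (relax a (relax a (fn n)) (Rabs x))).
        { apply Rmult_le_pos; [apply Hg0, Rabs_pos|apply pw_nonneg]. }
        lra.
      + intro x. unfold fn. simpl. unfold force_step. fold fn. fold (fn n).
        destruct (Hband (fn n)) with (s := Rabs x) as (Hr0 & _ & Hr); auto.
        { intro y. specialize (IHB y). lra. }
        { intros y Hy. specialize (IH y). now rewrite (Rabs_pos_eq y Hy) in IH. }
        { apply Rabs_pos. }
        destruct (Hphi (Rabs x) (Rabs_pos x)) as (H0 & H2 & _).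
        apply Rle_trans with (2 := H2).
        set (r := relax a (relax a (fn n)) (Rabs x)) in *.
        assert (HgA' := HgA _ (Rabs_pos x)).
        assert (Hg0' := Hg0 _ (Rabs_pos x)).
        assert (Hpw := pw_close al r rR ltac:(lra) HrR Hr0). fold P in Hpw.
        assert (HPr : 0 < P / rR) by (now apply Rdiv_lt_0_compat).
        replace (B + g (Rabs x) * pw al r - a * (a * rR))
          with (g (Rabs x) * (pw al r - P) + (g (Rabs x) - A) * P)
          by (rewrite Heq; ring).
        apply Rle_trans with (1 := Rabs_triang _ _).
        rewrite !Rabs_mult, (Rabs_pos_eq (g _)), (Rabs_pos_eq P) by lra.
        apply Rplus_le_compat; [|apply Rmult_le_compat_r; lra].
        rewrite Rmult_assoc. apply Rmult_le_compat.
        * exact Hg0'.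
        * apply Rabs_pos.
        * apply Rabs_le_between in HgA'. lra.
        * apply Rle_trans with (1 := Hpw). apply Rmult_le_compat_l; lra. }
  set (M := a * (a * rR) + K).
  assert (HnM : forall n x, fn n x <= M).
  { intros n x. destruct (Hinv n) as [_ [_ H]]. specialize (H x).
    destruct (Hphi (Rabs x) (Rabs_pos x)) as (_ & _ & _ & _ & HK).
    apply Rabs_le_between in H. unfold M. lra. }
  destruct (force_iter_converges a B al M g (fun _ => a * (a * rR)))
    as (f & Hfc & Hfix & Hptf); auto.
  { intro n. apply Hinv. }
  { intros n x. split; [apply Hinv|apply HnM]. }
  assert (HfB : forall x, B <= f x).
  { intro x. change (Rbar_le B (f x)).
    apply (is_lim_seq_le (fun _ => B) (fun n => fn n x)); auto.
    - intro n. apply Hinv.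
    - apply is_lim_seq_const. }
  assert (Hf2 : forall x, 0 <= x -> Rabs (f x - a * (a * rR)) <= Phi2 x).
  { intros x Hx.
    change (Rbar_le (Rabs (f x - a * (a * rR))) (Phi2 x)).
    apply (is_lim_seq_le (fun n => Rabs (fn n x - a * (a * rR)))
             (fun _ => Phi2 x)).
    - intro n. destruct (Hinv n) as [_ [_ H]]. specialize (H x).
      now rewrite (Rabs_pos_eq x Hx) in H.
    - apply (is_lim_seq_abs _ (f x - a * (a * rR))).
      apply is_lim_seq_minus'; [apply Hptf|apply is_lim_seq_const].
    - apply is_lim_seq_const. }
  exists f. split; [exact Hfc|]. split; [exact Hfix|]. split; [exact HfB|].
  exists b, K. split; [exact Hb|]. intros s Hs.
  destruct (Hband f) with (s := s) as (_ & H1 & H0); auto.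
  { intro y. specialize (HfB y). lra. }
  destruct (Hphi s Hs) as (_ & _ & K0 & K1 & _). split; lra.
Qed.

(** * Limits and expansions *)

Lemma filterlim_exp_decay (h : R -> R) (l b K : R) : 0 < b ->
  (forall s, 0 <= s -> Rabs (h s - l) <= K * exp (- (b * s))) ->
  filterlim h (Rbar_locally p_infty) (locally l).
Proof.
  intros Hb Hh. apply filterlim_locally. intros [eps Heps].
  assert (HK := Rabs_pos K).
  assert (HM : 0 < (Rabs K + 1) / eps / b)
    by (repeat apply Rdiv_lt_0_compat; lra).
  exists ((Rabs K + 1) / eps / b). intros s Hs.
  change (Rabs (h s - l) < eps).
  apply Rle_lt_trans with (1 := Hh s ltac:(lra)).
  assert (He := exp_pos (b * s)).
  assert (Hlt : Rabs K + 1 < eps * exp (b * s)).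
  { assert (H1 := exp_ineq1_le (b * s)).
    apply Rlt_le_trans with (eps * (b * s)).
    - replace (Rabs K + 1) with (eps * (b * ((Rabs K + 1) / eps / b)))
        by (field; lra).
      apply Rmult_lt_compat_l; [exact Heps|]. now apply Rmult_lt_compat_l.
    - apply Rmult_le_compat_l; lra. }
  rewrite exp_Ropp. apply Rmult_lt_reg_r with (exp (b * s)); [exact He|].
  rewrite Rmult_assoc, Rinv_l, Rmult_1_r by lra.
  assert (HKK := Rle_abs K). lra.
Qed.

Lemma filterlim_locally_pair {T : Type} {U V : UniformSpace}
    (F : (T -> Prop) -> Prop) {FF : Filter F} (f : T -> U) (g : T -> V) x y :
  filterlim f F (locally x) -> filterlim g F (locally y) ->
  filterlim (fun t => (f t, g t)) F (locally (x, y)).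
Proof.
  intros Hf Hg. apply filterlim_locally. intro eps.
  generalize (filter_and _ _ (proj1 (filterlim_locally _ _) Hf eps)
                (proj1 (filterlim_locally _ _) Hg eps)).
  apply filter_imp. intros t [H1 H2]. now split.
Qed.

Lemma filterlim_at_right_of_is_derive (h : R -> R) (x l : R) :
  is_derive h x l -> filterlim h (at_right x) (locally (h x)).
Proof.
  intro H. eapply filterlim_filter_le_1.
  - apply filter_le_within.
  - apply (ex_derive_continuous h). now exists l.
Qed.

Lemma expansion_first_order (h : R -> R) (l : R) :
  is_derive h 0 l -> h 0 = 0 ->
  expansion_at_0plus h (fun s => l * s) (fun s => s).
Proof.
  intros Hd H0 [eps Heps]. apply is_derive_Reals in Hd.
  destruct (Hd eps Heps) as [d Hd']. exists d. intros s Hs Hs0.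
  change (Rabs (h s - l * s) <= eps * Rabs s).
  assert (Hsd : Rabs s < d).
  { replace s with (s - 0) by ring. exact Hs. }
  specialize (Hd' s ltac:(lra) Hsd). rewrite Rplus_0_l, H0, Rminus_0_r in Hd'.
  replace (h s - l * s) with ((h s / s - l) * s) by (field; lra).
  rewrite Rabs_mult. apply Rmult_le_compat_r; [apply Rabs_pos|lra].
Qed.

(** The mean value theorem applied to [h - m s^2 / 2], whose derivative
    is [o(s)]. *)
Lemma expansion_second_order (h dh : R -> R) (m : R) :
  (forall s, is_derive h s (dh s)) -> is_derive dh 0 m ->
  h 0 = 0 -> dh 0 = 0 ->
  expansion_at_0plus h (fun s => m / 2 * s ^ 2) (fun s => s ^ 2).
Proof.
  intros Hd Hdd H0 Hd0 [eps Heps]. apply is_derive_Reals in Hdd.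
  destruct (Hdd eps Heps) as [d Hd']. exists d. intros s Hs Hs0.
  change (Rabs (h s - m / 2 * s ^ 2) <= eps * Rabs (s ^ 2)).
  assert (Hsd : Rabs s < d).
  { replace s with (s - 0) by ring. exact Hs. }
  rewrite (Rabs_pos_eq s) in Hsd by lra.
  assert (Hdl : forall z, is_derive (fun s => h s - m / 2 * s ^ 2) z (dh z - m * z)).
  { intro z. apply (is_derive_minus h (fun s => m / 2 * s ^ 2)); [apply Hd|].
    auto_derive; auto. field. }
  destruct (MVT_gen (fun s => h s - m / 2 * s ^ 2) 0 s (fun z => dh z - m * z))
    as [z [Hz Hf]].
  - intros z _. apply Hdl.
  - intros z _. exact (continuity_pt_of_is_derive _ _ _ (Hdl z)).
  - rewrite Rmin_left, Rmax_right in Hz by lra.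
    rewrite H0 in Hf.
    replace (h s - m / 2 * s ^ 2) with ((dh z - m * z) * s) by lra.
    assert (Hdz : Rabs (dh z - m * z) <= eps * s).
    { destruct (Req_dec z 0) as [->|Hz0].
      - rewrite Hd0. replace (0 - m * 0) with 0 by ring.
        rewrite Rabs_R0. apply Rmult_le_pos; lra.
      - assert (Hzd : Rabs z < d) by (rewrite Rabs_pos_eq; lra).
        specialize (Hd' z Hz0 Hzd). rewrite Rplus_0_l, Hd0, Rminus_0_r in Hd'.
        replace (dh z - m * z) with ((dh z / z - m) * z) by (field; lra).
        rewrite Rabs_mult, (Rabs_pos_eq z) by lra.
        apply Rmult_le_compat; try lra. apply Rabs_pos. }
    rewrite Rabs_mult, (Rabs_pos_eq s), (Rabs_pos_eq (s ^ 2))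
      by (try apply pow2_ge_0; lra).
    replace (eps * s ^ 2) with (eps * s * s) by ring.
    apply Rmult_le_compat_r; lra.
Qed.

(** * The reduced system *)

Lemma is_derive_pair {U V : NormedModule R_AbsRing} (f : R -> U) (g : R -> V)
    (x : R) (df : U) (dg : V) :
  is_derive f x df -> is_derive g x dg ->
  is_derive (fun t => (f t, g t) : prod_NormedModule R_AbsRing U V) x (df, dg).
Proof.
  intros Hf Hg.
  exact (filterdiff_comp'_2 (K := R_AbsRing) (T := AbsRing_NormedModule R_AbsRing)
           f g (fun u v => (u, v) : prod_NormedModule R_AbsRing U V) x
           (fun t => scal t df) (fun t => scal t dg) (fun u v => (u, v)) Hf Hg
           (filterdiff_linear _
              (is_linear_prod _ _ is_linear_fst is_linear_snd))).
Qed.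

Lemma moving_flux_conserved (alpha p c rho u v : R) : rho <> 0 ->
  moving_flux alpha p c (conserved rho u v) =
  (rho * (u - c), momentum_flux alpha p rho u v - c * (rho * u),
   rho * v * (u - c)).
Proof.
  intro Hrho. unfold moving_flux, conserved, flux.
  replace (rho * u / rho) with u by (field; exact Hrho).
  replace (rho * v / rho) with v by (field; exact Hrho).
  apply injective_projections; [apply injective_projections|];
    cbn; unfold mult; cbn; ring.
Qed.

(** Applying [pw_close] to the reciprocal [(1 - v) ^ p], which is possible since
    [p <= 1], makes differentiating the pressure unnecessary.  The number [m] is
    a lower bound for the distance of [v] to the singularity [v = 1]. *)
Lemma pressure_close (p v v0 m : R) : 0 <= p <= 1 -> v0 < 1 ->
  0 < m <= 1 - v ->
  Rabs (pressure p v - pressure p v0)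
  <= Rabs (v - v0) / ((1 - v0) * Rpower m p).
Proof.
  intros Hp Hv0 Hm. unfold pressure. rewrite !Rpower_Ropp.
  assert (H := pw_close p (1 - v) (1 - v0) Hp ltac:(lra) ltac:(lra)).
  rewrite pw_pos_eq in H by lra.
  assert (Hx := Rpower_pos (1 - v) p). assert (Hx0 := Rpower_pos (1 - v0) p).
  assert (Hxm := Rpower_pos m p).
  assert (Hmx : Rpower m p <= Rpower (1 - v) p) by (apply Rle_Rpower_l; lra).
  set (X := Rpower (1 - v) p) in *. set (X0 := Rpower (1 - v0) p) in *.
  replace (/ X - / X0) with (- ((X - X0) * / (X * X0))) by (field; lra).
  assert (HXX : 0 < / (X * X0)) by (apply Rinv_0_lt_compat, Rmult_lt_0_compat; lra).
  rewrite Rabs_Ropp, Rabs_mult, (Rabs_pos_eq (/ _)) by lra.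
  replace (1 - v - (1 - v0)) with (- (v - v0)) in H by ring.
  rewrite Rabs_Ropp in H.
  apply Rle_trans with (X0 / (1 - v0) * Rabs (v - v0) * / (X * X0)).
  - apply Rmult_le_compat_r; lra.
  - replace (X0 / (1 - v0) * Rabs (v - v0) * / (X * X0))
      with (Rabs (v - v0) / (1 - v0) * / X) by (field; lra).
    replace (Rabs (v - v0) / ((1 - v0) * Rpower m p))
      with (Rabs (v - v0) / (1 - v0) * / Rpower m p) by (field; lra).
    apply Rmult_le_compat_l.
    + apply Rdiv_le_0_compat; [apply Rabs_pos|lra].
    + apply Rinv_le_contravar; lra.
Qed.

Lemma reparametrized_trajectory_of_inverse_density
    (alpha p rhoR uR vR c a B : R) (r y v : R -> R) :
  0 < rhoR ->
  a = rhoR * (c - uR) ->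
  B = rhoR * (c - uR) ^ 2 - pressure p vR / Rpower rhoR alpha ->
  (forall s, 0 < s -> 0 < r s /\ v s < 1) ->
  (forall s, 0 < s -> is_derive r s (y s - a * r s)) ->
  (forall s, 0 < s ->
     is_derive y s (B + pressure p (v s) * Rpower (r s) alpha - a * y s)) ->
  (forall s, 0 < s -> is_derive v s (a * (vR - v s))) ->
  reparametrized_trajectory alpha p c
    (moving_flux alpha p c (conserved rhoR uR vR))
    (fun s => / r s) (fun s => c - y s) v.
Proof.
  intros HrhoR Ha HB Hadm Hr Hy Hv.
  set (X := fun s => conserved (/ r s) (c - y s) (v s)).
  set (W := moving_flux alpha p c (conserved rhoR uR vR)).
  destruct (time_change (V := prod_NormedModule _ (prod_NormedModule _ _ _) _)
              (fun s => / r s) X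
              (fun s => minus (moving_flux alpha p c (X s)) W))
    as (tau & Hs & H).
  - intros s Hs. destruct (Hadm s Hs) as [Hr0 _].
    apply (ex_derive_continuous (fun s => / r s)).
    eexists. apply (is_derive_inv r); [now apply Hr|lra].
  - intros s Hs. apply Rinv_0_lt_compat. now apply Hadm.
  - intros s Hs. destruct (Hadm s Hs) as [Hr0 _].
    assert (Hri : / r s <> 0) by (apply Rinv_neq_0_compat; lra).
    assert (Hrho : is_derive (fun s => / r s) s (- (y s - a * r s) / r s ^ 2)).
    { apply (is_derive_inv r); [now apply Hr|lra]. }
    assert (Hru := is_derive_mult (fun s => / r s) (fun s => c - y s) s _ _ Hrho
      (is_derive_minus (fun _ => c) y s _ _
         (is_derive_const (V := R_NormedModule) c s) (Hy s Hs)) Rmult_comm).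
    assert (Hrv := is_derive_mult (fun s => / r s) v s _ _ Hrho (Hv s Hs) Rmult_comm).
    assert (HX := is_derive_pair _ _ _ _ _ (is_derive_pair _ _ _ _ _ Hrho Hru) Hrv).
    match type of HX with is_derive _ _ ?d =>
      match goal with |- is_derive _ _ ?e => replace e with d end end.
    + exact HX.
    + unfold X, W. rewrite !moving_flux_conserved by lra.
      unfold momentum_flux.
      rewrite (Rpower_Ropp rhoR).
      assert (HRr : Rpower (/ r s) (- alpha) = Rpower (r s) alpha).
      { unfold Rpower. f_equal. rewrite ln_Rinv by lra. ring. }
      rewrite HRr, HB, Ha.
      assert (HP := Rpower_pos rhoR alpha).
      apply injective_projections; [apply injective_projections|];
        cbn; unfold mult; cbn; field; lra.
  - exists tau, Hs. intros s Hs0. destruct (H s Hs0) as (H1 & H2 & H3).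
    destruct (Hadm s Hs0) as [Hr0 Hv1].
    split; [split; [now apply Rinv_0_lt_compat|exact Hv1]|].
    split; [exact H1|]. split; [exact H2|]. rewrite H2. exact H3.
Qed.

(** * The trajectory leaving the singular shock *)

Theorem proposition2
  (alpha p rhoL uL vL rhoR uR vR c vdelta : R)
  (halpha : 0 < alpha <= 1)
  (hp : 0 < p <= alpha)
  (hL : admissible rhoL vL)
  (hR : admissible rhoR vR)
  (hshock : singular_shock alpha p rhoL uL vL rhoR uR vR c vdelta)
  (hvdelta : vdelta < 1)
  (hyR : 0 < c - uR)
  (hBR : 0 < rhoR * (c - uR) ^ 2 - pressure p vR / Rpower rhoR alpha) :
  let BR := rhoR * (c - uR) ^ 2 - pressure p vR / Rpower rhoR alpha in
  let WR := moving_flux alpha p c (conserved rhoR uR vR) in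
  let w1R := fst (fst WR) in
  let w3R := snd WR in
  let GammaR := vdelta * w1R - w3R in
  (exists rho u v : R -> R,
    reparametrized_trajectory alpha p c WR rho u v /\
    filterlim (fun zeta => (rho zeta, u zeta, v zeta))
      (Rbar_locally p_infty) (locally (rhoR, uR, vR)) /\
    filterlim rho (at_right 0) (Rbar_locally p_infty) /\
    filterlim u (at_right 0) (locally c) /\
    filterlim v (at_right 0) (locally vdelta) /\
    expansion_at_0plus (fun zeta => c - u zeta)
      (fun zeta => BR * zeta) (fun zeta => zeta) /\
    expansion_at_0plus (fun zeta => 1 / rho zeta)
      (fun zeta => BR / 2 * zeta ^ 2) (fun zeta => zeta ^ 2) /\
    expansion_at_0plus (fun zeta => v zeta - vdelta)
      (fun zeta => GammaR * zeta) (fun zeta => zeta)) /\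
  GammaR = rhoR * (uR - c) * (vdelta - vR).
Proof.
  intros BR WR w1R w3R GammaR. change (0 < BR) in hBR.
  destruct hR as [HrhoR HvR].
  assert (HGamma : GammaR = rhoR * (uR - c) * (vdelta - vR)).
  { unfold GammaR, w1R, w3R, WR. rewrite moving_flux_conserved by lra. simpl. ring. }
  split; [|exact HGamma].
  clearbody GammaR. clear w1R w3R hL hshock.
  set (a := rhoR * (c - uR)).
  assert (Ha : 0 < a) by (now apply Rmult_lt_0_compat).
  set (v := fun s => vR + (vdelta - vR) * exp (- (a * s))).
  assert (Hdv : forall s, is_derive v s (a * (vR - v s))).
  { intro s. unfold v. auto_derive; auto. ring. }
  set (m := Rmin (1 - vdelta) (1 - vR)).
  assert (Hm : 0 < m) by (apply Rmin_glb_lt; lra).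
  (* v stays between vdelta and vR *)
  assert (Hvm : forall s, 0 <= s -> m <= 1 - v s).
  { intros s Hs. assert (H1 := Rmin_l (1 - vdelta) (1 - vR)).
    assert (H2 := Rmin_r (1 - vdelta) (1 - vR)). fold m in H1, H2.
    assert (HE0 := exp_pos (- (a * s))).
    assert (HE1 : exp (- (a * s)) <= 1)
      by (rewrite <- exp_0; apply exp_increasing_le; nra).
    unfold v. nra. }
  set (A := pressure p vR).
  assert (HA : 0 < A) by apply Rpower_pos.
  assert (HrR : 0 < / rhoR) by (now apply Rinv_0_lt_compat).
  assert (HmP := Rpower_pos m p).
  assert (Hden : 0 < (1 - vR) * Rpower m p) by (apply Rmult_lt_0_compat; lra).
  destruct (singular_oscillator a BR alpha A (/ rhoR)
              (Rabs (vdelta - vR) / ((1 - vR) * Rpower m p))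
              (fun s => pressure p (v s)))
    as (f & Hfc & Hf & HfB & b & K & Hb & Hlim); auto.
  - apply Rdiv_le_0_compat; [apply Rabs_pos|exact Hden].
  - assert (Hpr : Rpower (/ rhoR) alpha = / Rpower rhoR alpha).
    { unfold Rpower. rewrite <- exp_Ropp. f_equal. rewrite ln_Rinv by lra. ring. }
    rewrite Hpr. unfold BR, a, A. assert (H := Rpower_pos rhoR alpha).
    field. lra.
  - intros s Hs. unfold pressure, Rpower.
    apply (ex_derive_continuous (fun s => exp (- p * ln (1 - v s)))).
    assert (Hvs := Hvm s Hs). eexists. auto_derive; [|reflexivity].
    split; [|lra]. eexists. apply Hdv.
  - intros s _. apply Rlt_le, Rpower_pos.
  - intros s Hs.
    apply Rle_trans with (1 := pressure_close p (v s) vR m ltac:(lra) HvR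
                                 (conj Hm (Hvm s Hs))).
    right. unfold v.
    replace (vR + (vdelta - vR) * exp (- (a * s)) - vR)
      with ((vdelta - vR) * exp (- (a * s))) by ring.
    rewrite Rabs_mult, (Rabs_pos_eq (exp _)) by (apply Rlt_le, exp_pos).
    field. lra.
  - set (y := relax a f) in *. set (r := relax a y) in *.
    assert (Hyc : forall s, continuous y s) by (now apply continuous_relax).
    assert (Hdy : forall s, is_derive y s (f s - a * y s))
      by (now apply is_derive_relax).
    assert (Hdr : forall s, is_derive r s (y s - a * r s))
      by (now apply is_derive_relax).
    assert (Hy0 : y 0 = 0) by apply relax_0.
    assert (Hr0 : r 0 = 0) by apply relax_0.
    assert (Hrpos : forall s, 0 < s -> 0 < r s).
    { apply relax_pos; [exact Hyc|]. apply relax_pos; [exact Hfc|].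
      intros s _. specialize (HfB s). lra. }
    assert (Hf0 : f 0 = BR).
    { rewrite Hf. unfold force_step. fold y r. rewrite Rabs_R0, Hr0. unfold pw.
      destruct (Rle_dec 0 0) as [_|]; [ring|lra]. }
    assert (Hdy0 : is_derive y 0 BR).
    { replace BR with (f 0 - a * y 0) by (rewrite Hf0, Hy0; ring). apply Hdy. }
    assert (Hdr0 : is_derive r 0 0).
    { replace 0 with (y 0 - a * r 0) at 2 by (rewrite Hr0, Hy0; ring). apply Hdr. }
    exists (fun s => / r s), (fun s => c - y s), v.
    split; [|split; [|split; [|split; [|split; [|split; [|split]]]]]].
    + apply (reparametrized_trajectory_of_inverse_density
               alpha p rhoR uR vR c a BR); auto.
      * intros s Hs. split; [now apply Hrpos|].
        assert (H := Hvm s (Rlt_le _ _ Hs)). lra.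
      * intros s Hs. assert (H := Hdy s). rewrite Hf in H at 1.
        unfold force_step in H. fold y r in H.
        rewrite (Rabs_pos_eq s), pw_pos_eq in H; [exact H|now apply Hrpos|lra].
    + assert (Hliml : forall h l, (forall s, 0 <= s ->
                 Rabs (h s - l) <= K * exp (- (b * s))) ->
               filterlim h (Rbar_locally p_infty) (locally l))
        by (intros h l H; now apply (filterlim_exp_decay h l b K)).
      apply filterlim_locally_pair; [typeclasses eauto| |];
        [apply filterlim_locally_pair; [typeclasses eauto| |]|].
      * rewrite <- (Rinv_inv rhoR).
        apply (filterlim_comp _ _ _ r Rinv _ (locally (/ rhoR))).
        -- apply Hliml. intros s Hs. now apply Hlim.
        -- apply (ex_derive_continuous Rinv). auto_derive. lra.
      * replace uR with (c - a * / rhoR) by (unfold a; field; lra).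
        apply (filterlim_comp _ _ _ y (fun y => c - y) _ (locally (a * / rhoR))).
        -- apply Hliml. intros s Hs. now apply Hlim.
        -- apply (ex_derive_continuous (fun y => c - y)). auto_derive. auto.
      * apply (filterlim_exp_decay v vR a (Rabs (vdelta - vR))); [exact Ha|].
        intros s _. right. unfold v.
        replace (vR + (vdelta - vR) * exp (- (a * s)) - vR)
          with ((vdelta - vR) * exp (- (a * s))) by ring.
        rewrite Rabs_mult, (Rabs_pos_eq (exp _)) by (apply Rlt_le, exp_pos).
        reflexivity.
    + apply (filterlim_comp _ _ _ r Rinv _ (at_right 0)).
      * intros P [d Hd].
        assert (H := filterlim_at_right_of_is_derive r 0 0 Hdr0). rewrite Hr0 in H.
        assert (HP := proj1 (filterlim_locally _ _) H d).
        destruct HP as [e He]. exists e. intros s Hs Hs0.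
        apply Hd; [now apply He|now apply Hrpos].
      * apply filterlim_Rinv_0_right.
    + assert (H := filterlim_at_right_of_is_derive (fun s => c - y s) 0 (0 - BR)).
      cbv beta in H. rewrite Hy0, Rminus_0_r in H. apply H.
      apply (is_derive_minus (fun _ => c) y); [|exact Hdy0].
      apply (is_derive_const (V := R_NormedModule) c 0).
    + replace vdelta with (v 0).
      * exact (filterlim_at_right_of_is_derive v 0 _ (Hdv 0)).
      * unfold v. rewrite Rmult_0_r, Ropp_0, exp_0. ring.
    + intro eps. generalize (expansion_first_order y BR Hdy0 Hy0 eps).
      apply filter_imp. intros s Hs.
      now replace (c - (c - y s)) with (y s) by ring.
    + assert (Hddr : is_derive (fun s => y s - a * r s) 0 BR).
      { replace BR with (BR - a * 0) by ring.
        apply (is_derive_minus y (fun s => a * r s)); [exact Hdy0|].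
        now apply (is_derive_scal r 0 a 0). }
      assert (H := expansion_second_order r (fun s => y s - a * r s) BR Hdr Hddr Hr0
                     ltac:(cbv beta; rewrite Hy0, Hr0; ring)).
      intro eps. generalize (H eps).
      apply filter_imp. intros s Hs.
      replace (1 / / r s) with (r s); [exact Hs|].
      unfold Rdiv. now rewrite Rinv_inv, Rmult_1_l.
    + assert (Hv0 : v 0 = vdelta)
        by (unfold v; rewrite Rmult_0_r, Ropp_0, exp_0; ring).
      apply (expansion_first_order (fun s => v s - vdelta)).
      * replace GammaR with (a * (vR - v 0) - 0)
          by (rewrite HGamma, Hv0; unfold a; ring).
        apply (is_derive_minus v (fun _ => vdelta)); [apply Hdv|].
        apply (is_derive_const (V := R_NormedModule) vdelta 0).
      * rewrite Hv0. ring.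
Qed.
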